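(* Let $n$ be a positive integer. Every Baire topology $\tau$ on $\mathscr{IO}_{\infty}(\mathbb{Z}^n_{\mathrm{lex}})$ such that $(\mathscr{IO}_{\infty}(\mathbb{Z}^n_{\mathrm{lex}}),\tau)$ is a Hausdorff semitopological semigroup is discrete.
   Context: $L_n=\{1,\ldots,n\}$ with its usual order; $L_n\times_{\mathrm{lex}}\mathbb{Z}$ is $L_n\times\mathbb{Z}$ with the lexicographic order: $(i,m)\leqslant(j,l)$ iff $i<j$, or $i=j$ and $m\le l$. $\mathscr{IO}_{\infty}(\mathbb{Z}^n_{\mathrm{lex}})$ is the inverse monoid of all injective partial maps $\alpha$ from $L_n\times\mathbb{Z}$ to itself that are monotone ($x\leqslant y$ in $\operatorname{dom}\alpha$ implies $(x)\alpha\leqslant(y)\alpha$) and such that both $\operatorname{dom}\alpha$ and $\operatorname{ran}\alpha$ have finite complement in $L_n\times\mathbb{Z}$; the operation is composition of partial maps written on the right, $(x)(\alpha\beta)=((x)\alpha)\beta$. A semitopological semigroup is a Hausdorff topological space with a separately continuous semigroup operation. A topology is Baire if for each sequence $A_1,A_2,\ldots$ of nowhere dense subsets, the complement of $\bigcup_{i=1}^\infty A_i$ is dense. *)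

(* Defs.v *)
From HB Require Import structures.
From mathcomp Require Import all_boot all_order all_algebra.
From mathcomp Require Import all_classical topology.

Set Implicit Arguments.
Unset Strict Implicit.
Unset Printing Implicit Defensive.

Import Order.TTheory.

Local Open Scope classical_set_scope.

(* The chain L_n is 'I_n = {0 < ... < n-1} instead of {1 < ... < n};
   *l is the lexicographic product of ordered types. *)
Notation Zlex n := ('I_n *l int)%type.

(* A partial map from T to itself is a function T -> option T. *)
Section PartialMaps.
Context {d : Order.disp_t} {T : porderType d}.
Implicit Types f g : T -> option T.

Definition pdom f : set T := [set x | exists y, f x = Some y].

Definition pran f : set T := [set y | exists x, f x = Some y].

Definition pinjective f := forall x y z, f x = Some z -> f y = Some z -> x = y.

Definition pmonotone f := forall x y x' y',
  f x = Some x' -> f y = Some y' -> (x <= y)%O -> (x' <= y')%O.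

Lemma pcomp_Some f g (x z : T) :
  pcomp f g x = Some z <-> exists2 y, g x = Some y & f y = Some z.
Proof.
rewrite /pcomp; case gx: (g x) => [y|] /=; split => //.
- by move=> fy; exists y.
- by case=> _ [<-].
- by case.
Qed.

End PartialMaps.

Record IOinf (n : nat) := MkIOinf {
  pmap_of :> Zlex n -> option (Zlex n);
  IOinf_inj : pinjective pmap_of;
  IOinf_mono : pmonotone pmap_of;
  IOinf_dom : cofinite_set (pdom pmap_of);
  IOinf_ran : cofinite_set (pran pmap_of) }.

HB.instance Definition _ n := gen_eqMixin (IOinf n).
HB.instance Definition _ n := gen_choiceMixin (IOinf n).

Section Monoid.
Variable n : nat.
Implicit Types a b c : IOinf n.

Lemma IOinf_eq a b : pmap_of a = pmap_of b -> a = b.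
Proof.
case: a b => [f f1 f2 f3 f4] [g g1 g2 g3 g4] /= fg; subst g.
by congr MkIOinf; exact: Prop_irrelevance.
Qed.

Lemma comp_inj a b : pinjective (pcomp b a).
Proof.
move=> x y z /pcomp_Some[u au bu] /pcomp_Some[v av bv].
by apply: (IOinf_inj au); rewrite av (IOinf_inj bu bv).
Qed.

Lemma comp_mono a b : pmonotone (pcomp b a).
Proof.
move=> x y x' y' /pcomp_Some[u au bu] /pcomp_Some[v av bv] xy.
by apply: (IOinf_mono bu bv); exact: (IOinf_mono au av xy).
Qed.

Lemma comp_dom a b : cofinite_set (pdom (pcomp b a)).
Proof.
pose g y := xget y [set x | a x = Some y].
have gE x y : a x = Some y -> g y = x.
  move=> axy; rewrite /g; case: xgetP => [z _ /= azy|/(_ x)//].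
  exact: IOinf_inj azy axy.
apply: (@sub_finite_set _ _ (~` pdom a `|` g @` (~` pdom b))); last first.
  rewrite finite_setU; split; first exact: IOinf_dom.
  by apply: finite_image; exact: IOinf_dom.
move=> x /= xN; case: (pselect (pdom a x)) => [[y axy]|]; last by left.
right; exists y; last exact: gE.
by move=> [z byz]; apply: xN; exists z; apply/pcomp_Some; exists y.
Qed.

Lemma comp_ran a b : cofinite_set (pran (pcomp b a)).
Proof.
pose g y := odflt y (b y).
apply: (@sub_finite_set _ _ (~` pran b `|` g @` (~` pran a))); last first.
  rewrite finite_setU; split; first exact: IOinf_ran.
  by apply: finite_image; exact: IOinf_ran.
move=> z /= zN; case: (pselect (pran b z)) => [[y byz]|]; last by left.
right; exists y; last by rewrite /g byz.
by move=> [x axy]; apply: zN; exists x; apply/pcomp_Some; exists y.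
Qed.

(* Maps are written on the right: a * b is a followed by b. *)
Definition IOinf_mul a b : IOinf n :=
  MkIOinf (@comp_inj a b) (@comp_mono a b) (comp_dom a b) (comp_ran a b).

Lemma id_inj : pinjective (@Some (Zlex n)).
Proof. by move=> x y z [->] [->]. Qed.

Lemma id_mono : pmonotone (@Some (Zlex n)).
Proof. by move=> x y x' y' [->] [->]. Qed.

Lemma id_dom : cofinite_set (pdom (@Some (Zlex n))).
Proof.
by apply: (sub_finite_set _ (finite_set0 _)) => x /= []; exists x.
Qed.

Lemma id_ran : cofinite_set (pran (@Some (Zlex n))).
Proof.
by apply: (sub_finite_set _ (finite_set0 _)) => x /= []; exists x.
Qed.

Definition IOinf_one : IOinf n := MkIOinf id_inj id_mono id_dom id_ran.

Lemma IOinf_mulA : associative IOinf_mul.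
Proof.
move=> a b c; apply: IOinf_eq; apply/funext => x /=.
by rewrite /pcomp; case: (a x).
Qed.

Lemma IOinf_mul1x : left_id IOinf_one IOinf_mul.
Proof. by move=> a; apply: IOinf_eq. Qed.

Lemma IOinf_mulx1 : right_id IOinf_one IOinf_mul.
Proof.
move=> a; apply: IOinf_eq; apply/funext => x /=.
by rewrite /pcomp; case: (a x).
Qed.

End Monoid.

HB.instance Definition _ n :=
  isMonoid.Build (IOinf n) (@IOinf_mulA n) (@IOinf_mul1x n) (@IOinf_mulx1 n).

Record topology_on (S : Type) := TopologyOn {
  opens : set (set S);
  opensT : opens setT;
  opensI : setI_closed opens;
  opens_bigU : forall (I : Type) (f : I -> set S),
    (forall i, opens (f i)) -> opens (\bigcup_i f i) }.

(* The set S seen as a topologicalType whose open sets are those of tau. *)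
Definition topologized (S : Type) (tau : topology_on S) : Type := S.

HB.instance Definition _ (S : choiceType) (tau : topology_on S) :=
  Choice.copy (topologized tau) S.
HB.instance Definition _ (S : choiceType) (tau : topology_on S) :=
  isOpenTopological.Build (topologized tau)
    (opensT tau) (@opensI _ tau) (@opens_bigU _ tau).

Definition semitopological_semigroup (S : semigroupType) (tau : topology_on S) :=
  [/\ hausdorff_space (topologized tau),
      forall a : S, continuous ((fun x => (a * x)%g)
        : topologized tau -> topologized tau) &
      forall a : S, continuous ((fun x => (x * a)%g)
        : topologized tau -> topologized tau)].

Definition nowhere_dense {T : topologicalType} (A : set T) :=
  interior (closure A) = set0.

Definition baire_space (T : topologicalType) :=
  forall A : nat -> set T, (forall i, nowhere_dense (A i)) ->
    dense (~` \bigcup_i A i).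

Definition discrete_space (T : topologicalType) := forall A : set T, open A.

(* Main.v *)
(* The monoid is countable, since each of its elements commutes with the
   successor map off a finite set. A countable Baire T1 space has an isolated
   point s. Every a satisfies b a c = s for some b and c, and injectivity makes
   the fibers of left and right translations finite; so the open set
   {x | b x c = s} is reduced in two steps to {a} by removing finitely many
   points. *)
Require Import Defs.
From HB Require Import structures.
From mathcomp Require Import all_boot all_order all_algebra.
From mathcomp Require Import all_classical topology.
From mathcomp Require Import zify.

Set Implicit Arguments.
Unset Strict Implicit.
Unset Printing Implicit Defensive.

Import Order.TTheory GRing.Theory Num.Theory.

Local Open Scope classical_set_scope.

(** Used to bound fibers of translations: solutions differ from a known map only on a finite set,
    with finitely many possible values there. By induction on a list of [F], resetting the value at
    the head to [h z] leaves a modification supported on the tail. *)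
Lemma finite_modifications (T : eqType) (U : Type) (F : set T) (G : set U)
    (h : T -> U) :
  finite_set F -> finite_set G ->
  finite_set [set f : T -> U | forall x, f x = h x \/ F x /\ G (f x)].
Proof.
move=> /finite_seqP[s ->] finG; elim: s => [|z s IHs].
  apply: (@sub_finite_set _ _ [set h]) => // f fh; apply/funext => x.
  by case: (fh x) => // -[].
pose upd u (f : T -> U) x := if x == z then u else f x.
have finG' : finite_set (G `|` [set h z]) by rewrite finite_setU.
apply: sub_finite_set (finite_image2 upd finG' IHs) => f /= fh.
exists (f z); first by case: (fh z) => [->|[]]; [right|left].
exists (upd (h z) f) => [x|].
  rewrite /upd; case: eqVneq => [->|xz]; first by left.
  case: (fh x) => [->|[xs Gfx]]; first by left.
  by right; split=> //; move: xs; rewrite /= inE (negbTE xz).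
by apply/funext => x; rewrite /upd; case: eqP => // ->.
Qed.

(** * Isolated points in T1 spaces *)

Section IsolatedPoints.
Variable T : topologicalType.

Lemma open1_continuous (U : topologicalType) (f : T -> U) (a : T) :
  accessible_space T -> continuous f -> open [set f a] ->
  finite_set [set x | f x = f a] -> open [set a].
Proof.
move=> T1 fC ofa fin_fiber.
have -> : [set a] = f @^-1` [set f a] `&` ~` ([set x | f x = f a] `\ a).
  apply/seteqP; split=> [x ->|x [/= fx nx]]; first by split=> [|[_]] /=.
  by apply: contrapT => xa; apply: nx; split.
apply: openI; first by apply: open_comp => // x _; exact: fC.
apply: closed_openC; move/accessible_finite_set_closed: T1; apply.
exact: finite_setD.
Qed.

Lemma countable_baire_isolated (x0 : T) :
  accessible_space T -> countable [set: T] -> baire_space T ->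
  exists x : T, open [set x].
Proof.
move=> T1 /countable_injP[f finj] baireT; apply: contrapT => no_isolated.
(* Each fiber of the injection [f] is empty or a singleton, so the fibers form a cover indexed by
   all of [nat], even when [T] is finite. *)
pose A k := [set x | f x = k].
have nowhereA k : nowhere_dense (A k).
  have [->|/set0P[x Ax]] := eqVneq (A k) set0.
    by rewrite /nowhere_dense closure0 interior0.
  have -> : A k = [set x].
    apply/seteqP; split=> [y Ay|_ -> //]; apply: finj; rewrite ?inE //.
    by rewrite Ay Ax.
  rewrite /nowhere_dense -((closure_id _).1 (accessible_closed_set1 T1 (x:=x))).
  apply/eqP; apply: contrapT => /negP/set0P[y xy].
  have := interior_subset xy => /= yx; rewrite yx in xy.
  apply: no_isolated; exists x; rewrite openE => _ ->; exact: xy.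
have := baireT A nowhereA setT; case.
- by exists x0.
- exact: openT.
- by move=> x [_]; apply; exists (f x).
Qed.

End IsolatedPoints.

(** * Successors and finite boxes in the lexicographic chain *)

Section Zlex.
Variable n : nat.
Implicit Types x y z : Zlex n.

Definition zsucc x : Zlex n := (x.1, x.2 + 1)%R.

Lemma zsucc_inj : injective zsucc.
Proof. by move=> [i m] [j l] [-> /addIr->]. Qed.

Lemma zsucc_le x y : (x < y)%O = (zsucc x <= y)%O.
Proof.
case: x y => [i m] [j l]; rewrite /zsucc Order.ProdLexiOrder.ltEprodlexi.
by rewrite Order.ProdLexiOrder.leEprodlexi /= lezD1.
Qed.

Definition zbox (N : nat) : seq (Zlex n) :=
  [seq (i, m) | i <- enum 'I_n,
     m <- [seq Posz k | k <- iota 0 N.+1]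
       ++ [seq (- Posz k)%R | k <- iota 0 N.+1]].

Lemma mem_zbox N x : (`|x.2| <= N)%N -> x \in zbox N.
Proof.
case: x => i m /= mN; apply: allpairs_f; first by rewrite mem_enum.
rewrite mem_cat; case: (lerP 0 m)%R => m0.
  apply/orP; left; apply/mapP; exists `|m|%N; last by lia.
  by rewrite mem_iota; lia.
apply/orP; right; apply/mapP; exists `|m|%N; last by lia.
by rewrite mem_iota; lia.
Qed.

Lemma finite_zbounded (A : set (Zlex n)) :
  finite_set A -> exists N : nat, forall x, A x -> (`|x.2| < N)%N.
Proof.
move=> /finite_seqP[s ->]; exists (\max_(x <- s) `|x.2|.+1)%N => x xs.
exact: (@leq_bigmax_seq _ s xpredT (fun x => `|x.2|.+1)%N).
Qed.

End Zlex.

(** * Countability of the monoid *)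

Section Structure.
Variable n : nat.
Implicit Types a b c s : IOinf n.

Definition zsucc_from (N : nat) a := forall x : Zlex n, (N <= `|x.2|)%N ->
  exists y, a x = Some y /\ a (zsucc x) = Some (zsucc y).

(** Nothing lies strictly between a point and its successor. Hence the image [u] of [zsucc x] is at
    least [zsucc y], and the preimage [v] of [zsucc y] is at least [zsucc x]; monotonicity turns the
    latter into [u <= zsucc y]. *)
Lemma IOinf_zsucc a (x y : Zlex n) :
  a x = Some y -> pdom a (zsucc x) -> pran a (zsucc y) ->
  a (zsucc x) = Some (zsucc y).
Proof.
move=> ax [u axs] [v av].
have lt_xs : (x < zsucc x)%O by rewrite zsucc_le.
have yu : (zsucc y <= u)%O.
  rewrite -zsucc_le lt_neqAle (IOinf_mono ax axs (ltW lt_xs)) andbT.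
  apply/eqP => yu; rewrite -yu in axs.
  by move: lt_xs; rewrite -(IOinf_inj ax axs) ltxx.
have xv : (zsucc x <= v)%O.
  rewrite -zsucc_le ltNge; apply/negP => vx.
  by have := IOinf_mono av ax vx; rewrite -zsucc_le ltxx.
rewrite axs; congr Some; apply/le_anti.
by rewrite yu (IOinf_mono axs av xv).
Qed.

Lemma IOinf_eventually_zsucc a : exists N, zsucc_from N a.
Proof.
(* The exceptional points: [a] is undefined at [x] or at [zsucc x], or the successor of the image of
   [x] is not a value of [a]. *)
pose E := ~` pdom a `|` @zsucc n @^-1` (~` pdom a)
  `|` a @^-1` (Some @` (@zsucc n @^-1` (~` pran a))).
have finE : finite_set E.
  have succ_fin (A : set (Zlex n)) : finite_set A -> finite_set (@zsucc n @^-1` A).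
    by apply: finite_preimage => x y _ _; exact: zsucc_inj.
  rewrite !finite_setU; split; first split.
  - exact: IOinf_dom.
  - by apply: succ_fin; exact: IOinf_dom.
  - apply: finite_preimage.
      move=> x y; rewrite !inE => -[u _ au] _ axy.
      by apply: (IOinf_inj (esym au)); rewrite -axy.
    by apply: finite_image; apply: succ_fin; exact: IOinf_ran.
have [N NE] := finite_zbounded finE; exists N => x Nx.
have xE : ~ E x by move=> /NE; rewrite ltnNge Nx.
have [y axy] : pdom a x by apply: contrapT => ?; apply: xE; left; left.
exists y; split=> //; apply: IOinf_zsucc => //.
- by apply: contrapT => ?; apply: xE; left; right.
- by apply: contrapT => ?; apply: xE; right; exists y.
Qed.

(** In each copy of the integers the values spread outwards from the box, upwards by [zsucc] and
    downwards by cancelling it. *)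
Lemma zsucc_from_eq N a b : zsucc_from N a -> zsucc_from N b ->
  {in zbox n N, a =1 b} -> a = b.
Proof.
move=> aN bN ab; apply: IOinf_eq; apply/funext => -[i m].
have pos k : a (i, Posz (N + k)) = b (i, Posz (N + k)).
  elim: k => [|k IHk]; first by apply: ab; apply: mem_zbox => /=; lia.
  have [/= | y [ay]] := aN (i, Posz (N + k)); first by lia.
  have [/= | z [bz]] := bN (i, Posz (N + k)); first by lia.
  rewrite /zsucc /= -PoszD addn1 -addnS => -> ->.
  by move: IHk; rewrite ay bz => -[->].
have neg k : a (i, - Posz (N + k))%R = b (i, - Posz (N + k))%R.
  elim: k => [|k IHk]; first by apply: ab; apply: mem_zbox => /=; lia.
  (* The hypothesis is applied at the new, lower point, whose successor is the point already
     treated. *)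
  have [/= | y [ay]] := aN (i, - Posz (N + k.+1))%R; first by lia.
  have [/= | z [bz]] := bN (i, - Posz (N + k.+1))%R; first by lia.
  rewrite {1 3}/zsucc /=.
  have -> : (- Posz (N + k.+1) + 1 = - Posz (N + k))%R by lia.
  by rewrite IHk ay bz => -> /Some_inj/zsucc_inj->.
case: (leqP `|m| N) => mN; first by apply: ab; exact: mem_zbox.
case: (lerP 0 m)%R => m0.
  by have -> : m = Posz (N + (`|m| - N)) by lia.
by have -> : m = (- Posz (N + (`|m| - N)))%R by lia.
Qed.

Lemma countable_IOinf : countable [set: IOinf n].
Proof.
have [N NP] := choice IOinf_eventually_zsucc.
(* The threshold is part of the code, so that equal codes list values over the same box. *)
pose code a : nat * seq (option ('I_n * int)) :=
  (N a, [seq a x | x <- zbox n (N a)]).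
apply/countable_injP; exists (pickle \o code) => a b _ _.
move=> /(pcan_inj (@pickleK _))[eqN eqv]; apply: (zsucc_from_eq (NP a)); first by rewrite eqN; exact: NP.
by apply/eq_in_map; rewrite eqv -eqN.
Qed.

(** * Finiteness of the fibers of translations *)

Lemma finite_IOinf (A : set (IOinf n)) :
  finite_set [set pmap_of a | a in A] -> finite_set A.
Proof.
move=> finA; apply: sub_finite_set (finite_preimage _ finA).
  by move=> a Aa; exists a.
by move=> a b _ _; exact: IOinf_eq.
Qed.

(** On the range of [b], [x] agrees with [a]. Off it, injectivity of [x] keeps its values out of the
    range of [b * a], which leaves finitely many values, or [None]. *)
Lemma finite_mul_fiberl b a : finite_set [set x : IOinf n | (b * x = b * a)%g].
Proof.
apply: finite_IOinf.
have finG : finite_set (None |` Some @` (~` pran (b * a)%g)).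
  by rewrite finite_setU; split=> //; apply: finite_image; exact: IOinf_ran.
apply: sub_finite_set (finite_modifications a (IOinf_ran b) finG).
move=> _ [x /= bx <-] p; case: (pselect (pran b p)) => [[z bz]|Np].
  have := congr1 (fun c : IOinf n => c z) bx.
  by rewrite /= /pcomp bz /= => ->; left.
right; split=> //; case xp: (x p) => [q|]; [right|by left].
exists q => // -[w baw].
have /pcomp_Some[v bv xv] : (b * x)%g w = Some q by rewrite bx.
by apply: Np; exists w; rewrite bv (IOinf_inj xp xv).
Qed.

(** On the domain of [a * c], injectivity of [c] forces [x] to agree with [a]. Off it, [x] is
    undefined or takes a value outside the domain of [c]. *)
Lemma finite_mul_fiberr c a : finite_set [set x : IOinf n | (x * c = a * c)%g].
Proof.
apply: finite_IOinf.
have finG : finite_set (None |` Some @` (~` pdom c)).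
  by rewrite finite_setU; split=> //; apply: finite_image; exact: IOinf_dom.
apply: sub_finite_set (finite_modifications a (IOinf_dom (a * c)%g) finG).
move=> _ [x /= xc <-] p; case: (pselect (pdom (a * c)%g p)) => [[z acz]|Np].
  have := acz; rewrite -xc => /pcomp_Some[u xu cu].
  by move/pcomp_Some: acz => [v av cv]; left; rewrite xu av (IOinf_inj cu cv).
right; split=> //; case xp: (x p) => [q|]; [right|by left].
exists q => // -[w cw]; apply: Np; exists w.
by rewrite -xc; apply/pcomp_Some; exists q.
Qed.

(** * Inverses, and factoring any element through a given one *)

Definition pinv (f : Zlex n -> option (Zlex n)) (y : Zlex n) :=
  if pselect (pran f y) is left fy then Some (projT1 (cid fy)) else None.

Lemma pinvP a (x y : Zlex n) : pinv a y = Some x <-> a x = Some y.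
Proof.
rewrite /pinv; case: pselect => [ay|Ny]; last first.
  by split=> // axy; case: Ny; exists x.
case: cid => z /= az; split=> [[<-] //|ax].
by rewrite (IOinf_inj az ax).
Qed.

Lemma inv_inj a : pinjective (pinv a).
Proof. by move=> x y z /pinvP az /pinvP; rewrite az => -[]. Qed.

Lemma inv_mono a : pmonotone (pinv a).
Proof.
move=> x y x' y' /pinvP ax /pinvP ay xy; rewrite leNgt; apply/negP => yx.
have le_yx := IOinf_mono ay ax (ltW yx).
have eq_xy : x = y by apply/le_anti; rewrite xy le_yx.
by rewrite eq_xy in ax; move: yx; rewrite (IOinf_inj ax ay) ltxx.
Qed.

Lemma inv_dom a : cofinite_set (pdom (pinv a)).
Proof.
apply: sub_finite_set (IOinf_ran a) => y; apply: contra_not.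
by move=> [x ax]; exists x; apply/pinvP.
Qed.

Lemma inv_ran a : cofinite_set (pran (pinv a)).
Proof.
apply: sub_finite_set (IOinf_dom a) => x; apply: contra_not.
by move=> [y ax]; exists y; apply/pinvP.
Qed.

Definition IOinf_inv a : IOinf n :=
  MkIOinf (@inv_inj a) (@inv_mono a) (inv_dom a) (inv_ran a).

Lemma mul_IOinf_inv a : pdom a = setT -> (a * IOinf_inv a = 1)%g.
Proof.
move=> aT; apply: IOinf_eq; apply/funext => x.
have [y ax] : pdom a x by rewrite aT.
by apply/pcomp_Some; exists y => //; apply/pinvP.
Qed.

(** Opens the gap [-N <= m < N] in every copy of the integers, so that a map applied afterwards may
    be undefined there. *)
Definition zstretch (N : nat) (x : Zlex n) : option (Zlex n) :=
  Some (x.1, if (0 <= x.2)%R then x.2 + N%:Z else x.2 - N%:Z)%R.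

Lemma zstretch_inj N : pinjective (zstretch N).
Proof.
move=> [i m] [j l] z <- [-> e]; congr pair; move: e.
by case: (lerP 0 l)%R; case: (lerP 0 m)%R => /=; lia.
Qed.

Lemma zstretch_mono N : pmonotone (zstretch N).
Proof.
move=> [i m] [j l] _ _ [<-] [<-]; rewrite !Order.ProdLexiOrder.leEprodlexi /=.
move=> /andP[-> /implyP ml]; apply/implyP => /ml.
by case: (lerP 0 l)%R; case: (lerP 0 m)%R; lia.
Qed.

Lemma zstretch_dom N : cofinite_set (pdom (zstretch N)).
Proof. by apply: sub_finite_set (finite_set0 _) => x []; eexists. Qed.

Lemma zstretch_ran N : cofinite_set (pran (zstretch N)).
Proof.
apply: sub_finite_set (finite_seq (zbox n N)) => -[i m] Nx.
apply: mem_zbox; rewrite leqNgt; apply/negP => /= Nm; apply: Nx.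
(* Since [N < |m|], undoing the shift preserves the sign of [m]. *)
exists (i, if (0 <= m)%R then m - N%:Z else m + N%:Z)%R.
rewrite /zstretch /=; congr (Some (_, _)).
by case: (lerP 0 m)%R => m0; case: ifPn; lia.
Qed.

Definition IOinf_stretch N : IOinf n :=
  MkIOinf (@zstretch_inj N) (@zstretch_mono N) (zstretch_dom N) (zstretch_ran N).

Lemma stretch_mul_total a : exists b, pdom (b * a)%g = setT.
Proof.
have [N NP] := finite_zbounded (IOinf_dom a).
exists (IOinf_stretch N); apply/seteqP; split=> // -[i m] _.
pose y : Zlex n := (i, if (0 <= m)%R then m + N%:Z else m - N%:Z)%R.
have [z az] : pdom a y.
  apply: contrapT => /NP; rewrite /y /=.
  by case: (lerP 0 m)%R; lia.
by exists z; apply/pcomp_Some; exists y.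
Qed.

(** Once a stretch [b] makes [b * a] total, [b * a] has a right inverse, and [c] is that inverse
    followed by [s]. *)
Lemma IOinf_simple a s : exists b c, (b * a * c = s)%g.
Proof.
have [b baT] := stretch_mul_total a.
exists b, (IOinf_inv (b * a)%g * s)%g.
by rewrite mulgA mul_IOinf_inv // mul1g.
Qed.

End Structure.

Theorem theorem4p1 (n : nat) (n_gt0 : (0 < n)%N) (tau : topology_on (IOinf n)) :
  baire_space (topologized tau) ->
  semitopological_semigroup tau ->
  discrete_space (topologized tau).
Proof.
move=> baire_tau [/hausdorff_accessible T1 lmul_cont rmul_cont].
have [s s_open] := @countable_baire_isolated (topologized tau)
  (IOinf_one n) T1 (countable_IOinf n) baire_tau.
have isolated (a : topologized tau) : open [set a].
  have [b [c bac]] := IOinf_simple a s.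
  (* Openness is pulled back from [b * a * c] to [b * a] by right translation, and from there to [a]
     by left translation; the goals appear in the reverse order. *)
  apply: (open1_continuous T1 (lmul_cont b)); last exact: finite_mul_fiberl.
  apply: (open1_continuous T1 (rmul_cont c)); last exact: finite_mul_fiberr.
  by rewrite bac.
move=> A; rewrite openE => x Ax.
by apply: filterS (open_nbhs_nbhs (conj (isolated x) erefl)) => y ->.
Qed.
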